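(* Let $\mathbb{F}$ be a field with $|\mathbb{F}|=3$. Let $s$ be a symplectic form on a finite-dimensional vector space $V$ over $\mathbb{F}$ and let $u\in\mathrm{Sp}(s)$ be cyclic with minimal polynomial $(t^2+1)(t-\eta)^2$ for some $\eta\in\{1,-1\}$. Then $u$ is not $4$-reflectional in $\mathrm{Sp}(s)$.
   Context: A symplectic form is a nondegenerate alternating bilinear form; $\mathrm{Sp}(s)$ is its isometry group in $\mathrm{GL}(V)$. An endomorphism is cyclic if it has a cyclic vector, i.e. its minimal polynomial equals its characteristic polynomial. An involution of a group is an element $i$ with $i^2$ equal to the identity (the identity is allowed). An element of a group is $k$-reflectional if it is the product of $k$ involutions of that group. *)

(* Defs.v *)
From HB Require Import structures.
From mathcomp Require Import all_boot all_order all_algebra.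
Set Implicit Arguments.
Unset Strict Implicit.
Unset Printing Implicit Defensive.
Import GRing.Theory.
Local Open Scope ring_scope.

Section Forms.
Variables (F : fieldType) (V : vectType F) (s : {biscalar V}).

(* Sesquilinear's is_psymplectic is stated for hermitian forms and asks for
   skew-symmetry; here the form is asked directly to be alternating. *)
Definition alternating : Prop := forall x : V, s x x = 0.

Definition nondegenerate_form : Prop :=
  forall x : V, (forall y : V, s x y = 0) -> x = 0.

Definition symplectic_form : Prop := alternating /\ nondegenerate_form.

(* On a finite-dimensional space, trivial kernel means membership in GL(V). *)
Definition Sp (u : 'End(V)) : Prop :=
  lker u = 0%VS /\ forall x y : V, s (u x) (u y) = s x y.

End Forms.

Section Endomorphisms.
Variables (F : fieldType) (V : vectType F).
Implicit Types (u : 'End(V)) (p q : {poly F}).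

(* The ring structure on 'End(V) in vector is not canonical, since 'End(V) is
   the zero ring when V = 0; hence the powers are iterated compositions. *)
Definition horner_lfun u p : 'End(V) :=
  \sum_(i < size p) p`_i *: iter i (comp_lfun u) \1%VF.

Definition is_minpoly u p : Prop :=
  [/\ p \is monic, horner_lfun u p = 0 &
      forall q, horner_lfun u q = 0 -> p %| q].

Definition cyclic_endo u : Prop :=
  exists x : V, forall y : V, exists p, y = horner_lfun u p x.

(* G stands for a subgroup of GL(V). *)
Definition involution_in (G : 'End(V) -> Prop) (i : 'End(V)) : Prop :=
  G i /\ (i \o i)%VF = \1%VF.

Definition reflectional (G : 'End(V) -> Prop) (k : nat) u : Prop :=
  exists2 r : k.-tuple 'End(V),
    forall j : 'I_k, involution_in G (tnth r j) &
    u = \big[@comp_lfun F V V V / \1%VF]_(j < k) tnth r j.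

End Endomorphisms.

(* Main.v *)
Require Import Defs.
From HB Require Import structures.
From mathcomp Require Import all_boot all_order all_algebra all_field ring.
Set Implicit Arguments.
Unset Strict Implicit.
Unset Printing Implicit Defensive.
Import GRing.Theory.
Local Open Scope ring_scope.

(** V is the orthogonal sum of the planes U = Ker (u^2 + 1) and W = Ker (u - eta)^2.
A noncentral involution of Sp(V) is a traceless self-adjoint operator, and these
operators form a 5-dimensional space in which X Y + Y X is always scalar.  Given
four involutions with product u, some nonzero X in this space anticommutes with
every noncentral one (four linear equations), so X u = u X or X u = - u X; this
forces X to be a multiple of the involution equal to 1 on U and to -1 on W.  Hence
each of the four involutions preserves or exchanges U and W.  On the group of
isometries with this property, summing over the two blocks a nontrivial character
chi : SL_2(3) -> F_3 gives a homomorphism to F_3.  It kills every involution, but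
its value at u is eta, because u is of order 4 on U and eta times a transvection
on W. *)

(** * The field with three elements *)

Lemma card3_char (F : finFieldType) : #|F| = 3%N -> 3%:R = 0 :> F.
Proof. by move=> hF; apply/pcharf0/(card_finPcharP (n := 1)). Qed.

Lemma card3_natP (F : finFieldType) : #|F| = 3%N ->
  forall x : F, exists2 n, (n < 3)%N & x = n%:R.
Proof.
move=> hF x; have: x ^+ 3 = x by rewrite -hF expf_card.
move=> x3; have /eqP : x * ((x - 1) * (x - 2%:R)) = 0
  by transitivity (3%:R * (x - x ^+ 2)); [ring: x3 | rewrite (card3_char hF) mul0r].
by rewrite !mulf_eq0 !subr_eq0 => /or3P[]/eqP->; [exists 0 | exists 1 | exists 2].
Qed.

Lemma ord2P (i : 'I_2) : i = 0 \/ i = 1.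
Proof. by case: i => [[|[|//]] hi]; [left | right]; apply/val_inj. Qed.

(** * Two-by-two blocks and the 5-dimensional space of [vec5] *)

Section Mx2.
Variable F : comNzRingType.
Implicit Types (P Q : 'M[F]_2).

Lemma mx2P P Q : P 0 0 = Q 0 0 -> P 0 1 = Q 0 1 -> P 1 0 = Q 1 0 ->
  P 1 1 = Q 1 1 -> P = Q.
Proof.
move=> h00 h01 h10 h11; apply/matrixP.
by move=> i j; have [->|->] := ord2P i; have [->|->] := ord2P j.
Qed.

Lemma mul2E P Q i j : (P *m Q) i j = P i 0 * Q 0 j + P i 1 * Q 1 j.
Proof.
by rewrite mxE !big_ord_recl big_ord0 addr0; congr (_ + P i _ * Q _ j); apply/val_inj.
Qed.

Lemma tr2E P : \tr P = P 0 0 + P 1 1.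
Proof.
by rewrite /mxtrace !big_ord_recl big_ord0 addr0; congr (_ + P _ _); apply/val_inj.
Qed.

Definition adj2 P := (\tr P)%:M - P.
Definition det2 P := P 0 0 * P 1 1 - P 0 1 * P 1 0.
(* [[0, 1], [-1, 0]]: the Gram matrix of a symplectic plane, and also the matrix of u
   on U in the basis used below. *)
Definition skew2 : 'M[F]_2 := \matrix_(i, j) ((j == 1)%:R - (i == 1)%:R).
Definition det2_polar P Q :=
  P 0 0 * Q 1 1 + P 1 1 * Q 0 0 - P 0 1 * Q 1 0 - P 1 0 * Q 0 1.
(* On SL_2(3) this is the character to F_3 sending [[1, 1], [0, 1]] to 1: the
   exponent, mod 3, of the multiplier of the eighth power of Dedekind's eta. *)
Definition chi P := (P 0 0 + P 1 1) * P 1 0 + P 0 1 * P 1 1 * (1 - P 1 0 ^+ 2).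

Local Ltac mx2_ring := apply/mx2P; rewrite ?(mul2E, mxE, tr2E) /=; ring.

Lemma det2M P Q : det2 (P *m Q) = det2 P * det2 Q.
Proof. by rewrite /det2 !mul2E; ring. Qed.

Lemma det20 : det2 0 = 0.
Proof. by rewrite /det2 !mxE mul0r subrr. Qed.

Lemma adj20 : adj2 0 = 0.
Proof. by rewrite /adj2 mxtrace0 raddf0 subr0. Qed.

Lemma mulmx_adj2 P : P *m adj2 P = (det2 P)%:M.
Proof. by rewrite /det2; mx2_ring. Qed.

Lemma adj2_mulmx P : adj2 P *m P = (det2 P)%:M.
Proof. by rewrite /det2; mx2_ring. Qed.

(** On a symplectic plane the adjoint is the adjugate, so self-adjointness for [skew4] becomes
    linear conditions on the blocks. *)
Lemma skew2_tr P : skew2 *m P^T = adj2 P *m skew2.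
Proof. by mx2_ring. Qed.

Lemma skew2K P : P *m skew2 *m skew2 = - P.
Proof. by mx2_ring. Qed.

Lemma skew2_inj P Q : P *m skew2 = Q *m skew2 -> P = Q.
Proof. by move=> h; apply/oppr_inj; rewrite -!skew2K h. Qed.

Definition skew4 : 'M[F]_(2 + 2) := block_mx skew2 0 0 skew2.
Definition diag4 P Q : 'M[F]_(2 + 2) := block_mx P 0 0 Q.
Definition anti4 P Q : 'M[F]_(2 + 2) := block_mx 0 P Q 0.

(* The general traceless matrix that is self-adjoint for skew4. *)
Definition vec5 (a : F) P : 'M[F]_(2 + 2) := block_mx a%:M P (adj2 P) (- a)%:M.

(** Clifford relations for the quadratic form [a ^+ 2 + det2 P]: the off-diagonal blocks of the two
    products cancel. *)
Lemma vec5_polar a P b Q :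
  vec5 a P *m vec5 b Q + vec5 b Q *m vec5 a P = (a * b *+ 2 + det2_polar P Q)%:M.
Proof.
rewrite /vec5 !mulmx_block add_block_mx [RHS]scalar_mx_block.
by congr block_mx; rewrite /det2_polar; mx2_ring.
Qed.

Lemma vec5_sqr a P : vec5 a P *m vec5 a P = (a ^+ 2 + det2 P)%:M.
Proof.
rewrite /vec5 !mulmx_block [RHS]scalar_mx_block.
by congr block_mx; rewrite /det2; mx2_ring.
Qed.

End Mx2.

(** * Products of four involutions of Sp_4(3), in matrix form *)

Section CharThree.
Variable F : fieldType.
Hypothesis F3 : forall x : F, exists2 n, (n < 3)%N & x = n%:R.
Hypothesis char3 : 3%:R = 0 :> F.
Implicit Types (P Q : 'M[F]_2) (M : 'M[F]_(2 + 2)).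

Lemma natr_mod3 n : (n %% 3)%:R = n%:R :> F.
Proof. by rewrite [in RHS](divn_eq n 3) natrD natrM char3 mulr0 add0r. Qed.

Lemma two_neg1 : 2%:R = - 1 :> F.
Proof. by apply/eqP; rewrite -addr_eq0 -[1]/(1%:R) -natrD char3. Qed.

Lemma two_neq0 : 2%:R != 0 :> F.
Proof. by rewrite two_neg1 oppr_eq0 oner_eq0. Qed.

Lemma eq_opp0 (x : F) : x = - x -> x = 0.
Proof.
by move/eqP; rewrite -addr_eq0 -mulr2n -mulr_natl mulf_eq0 (negPf two_neq0) => /eqP.
Qed.

(* A matrix ((a, b), (c, d)) with natural entries stands for its reduction mod 3, so
   that the multiplicativity of chi on SL_2(3) becomes a finite computation. *)
Definition chin (x : (nat * nat) * (nat * nat)) : nat :=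
  let: ((a, b), (c, d)) := x in (a + d) * c + b * d * (1 + 2 * c * c).

Definition muln3 (x y : (nat * nat) * (nat * nat)) :=
  let: ((a, b), (c, d)) := x in let: ((a', b'), (c', d')) := y in
  (((a * a' + b * c') %% 3, (a * b' + b * d') %% 3),
   ((c * a' + d * c') %% 3, (c * b' + d * d') %% 3))%N.

Definition sl2_mod3 : seq ((nat * nat) * (nat * nat)) :=
  let pairs := [seq (a, b) | a <- iota 0 3, b <- iota 0 3] in
  [seq x <- [seq (r, r') | r <- pairs, r' <- pairs] |
    x.1.1 * x.2.2 == 1 + x.1.2 * x.2.1 %[mod 3]].

Lemma chin_mul : all (fun x => all (fun y =>
  chin (muln3 x y) == chin x + chin y %[mod 3]) sl2_mod3) sl2_mod3.
Proof. by vm_compute. Qed.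

Definition natmx (x : (nat * nat) * (nat * nat)) : 'M[F]_2 :=
  \matrix_(i, j) (let r := if i == 0 then x.1 else x.2 in
                  if j == 0 then r.1 else r.2)%:R.

Lemma natr_eq_mod3 m n : m%:R = n%:R :> F -> m = n %[mod 3].
Proof.
have lt3 k : (k < 3)%N -> k%:R = 0 :> F -> k = 0%N.
  case: k => [|[|[|//]]] // _ /eqP; first by rewrite oner_eq0.
  by rewrite two_neg1 oppr_eq0 oner_eq0.
rewrite -[m%:R]natr_mod3 -[n%:R]natr_mod3.
have: (n %% 3 < 3)%N by rewrite ltn_mod.
have: (m %% 3 < 3)%N by rewrite ltn_mod.
wlog le_mn : m n / (m %% 3 <= n %% 3)%N.
  move=> wl hm hn h; have [/wl|/ltnW/wl] := leqP (m %% 3) (n %% 3); first exact.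
  by move=> ->.
move=> _ hn /esym/eqP; rewrite -subr_eq0 -natrB // => /eqP/lt3.
move=> /(_ (leq_ltn_trans (leq_subr _ _) hn))/eqP; rewrite subn_eq0 => le_nm.
by apply/eqP; rewrite eqn_leq le_mn.
Qed.

Lemma sl2_natmx P : det2 P = 1 -> exists2 x, x \in sl2_mod3 & P = natmx x.
Proof.
have [a la ea] := F3 (P 0 0); have [b lb eb] := F3 (P 0 1).
have [c lc ec] := F3 (P 1 0); have [d ld ed] := F3 (P 1 1).
rewrite /det2 ea eb ec ed -!natrM => /eqP.
rewrite subr_eq -(natrD _ 1) => /eqP/natr_eq_mod3 det1.
exists ((a, b), (c, d)); last by apply/mx2P; rewrite !mxE.
rewrite mem_filter; apply/andP; split; first by rewrite /= det1.
have in_pairs m n : (m < 3)%N -> (n < 3)%N ->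
  (m, n) \in [seq (i, j) | i <- iota 0 3, j <- iota 0 3].
  by move=> lm ln; apply/allpairsP; exists (m, n); split; rewrite // mem_iota.
by apply/allpairsP; exists ((a, b), (c, d)); split; rewrite ?in_pairs.
Qed.

Lemma chi_natmx x : chi (natmx x) = (chin x)%:R.
Proof.
(* The factor 2 in [chin] stands for -1. *)
case: x => [[a b] [c d]]; rewrite /chi /chin !mxE /= !(natrD, natrM) two_neg1.
by ring.
Qed.

Lemma natmxM x y : natmx x *m natmx y = natmx (muln3 x y).
Proof.
case: x y => [[a b] [c d]] [[a' b'] [c' d']].
by apply/mx2P; rewrite mul2E !mxE /= natr_mod3 natrD !natrM.
Qed.

Lemma chiM P Q : det2 P = 1 -> det2 Q = 1 -> chi (P *m Q) = chi P + chi Q.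
Proof.
move=> /sl2_natmx[x xs ->] /sl2_natmx[y ys ->]; rewrite natmxM !chi_natmx -natrD.
have /eqP h := allP (allP chin_mul _ xs) _ ys.
by rewrite -[LHS]natr_mod3 h natr_mod3.
Qed.

(** The hypothesis says that 2 P is the scalar [\tr P], and 2 = -1. *)
Lemma adj2_scalar P : adj2 P = P -> P = (- \tr P)%:M.
Proof.
rewrite /adj2 => /(canRL (subrK _)) h; rewrite (raddfN (@scalar_mx F 2)) /= h.
by rewrite -mulr2n -scaler_nat two_neg1 scaleN1r opprK.
Qed.

Lemma eq_scalar_mx n (a b : F) : a%:M = b%:M :> 'M[F]_n.+1 -> a = b.
Proof. by move/matrixP/(_ 0 0); rewrite !mxE eqxx. Qed.

(** Self-adjointness makes the diagonal blocks scalars a and d, and the lower left block the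
    adjugate of the upper right one Q. Squaring to 1 gives (a + d) Q = 0: either d = -a, or Q = 0
    and a = d is a sign. *)
Lemma involution_shape M : M *m M = 1%:M -> M *m skew4 F = skew4 F *m M^T ->
  [\/ M = 1%:M, M = (- 1)%:M | exists a B, M = vec5 a B].
Proof.
rewrite -[M]submxK; move: (ulsubmx _) (ursubmx _) (dlsubmx _) (drsubmx _) => P Q R S.
rewrite tr_block_mx /skew4 !mulmx_block !(mul0mx, mulmx0, addr0, add0r).
rewrite !skew2_tr => MM.
case/eq_block_mx=> [/skew2_inj eP /skew2_inj eQ /skew2_inj eR /skew2_inj eS].
move: MM; rewrite (adj2_scalar (esym eP)) (adj2_scalar (esym eS)) eR.
move: (- \tr P) (- \tr S) => a d {P S R eQ eR eP eS}.
rewrite [X in _ = X]scalar_mx_block => /eq_block_mx[].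
rewrite mulmx_adj2 adj2_mulmx -!scalar_mxM -!raddfD /=
  => /eq_scalar_mx e1 e2 _ /eq_scalar_mx e4.
have [ad|ad] := eqVneq (a + d) 0.
  by apply: Or33; exists a, Q; rewrite /vec5 -[d](addKr a) ad addr0.
have Q0 : Q = 0.
  move: e2; rewrite mul_scalar_mx mul_mx_scalar -scalerDl => /eqP.
  by rewrite scaler_eq0 (negPf ad) => /eqP.
move: e1 e4; rewrite Q0 det20 adj20 ?add0r addr0 => e1 e4.
have eda : d = a.
  apply/eqP; rewrite eq_sym -subr_eq0 -(mulIr_eq0 _ (mulIf ad)) mulrBl !mulrDr.
  by apply/eqP; transitivity (a * a - d * d); [ring | rewrite e1 e4 subrr].
rewrite eda; have /eqP : (a - 1) * (a + 1) = 0.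
  by transitivity (a * a - 1); [ring | rewrite e1 subrr].
rewrite mulf_eq0 subr_eq0 addr_eq0 => /orP[]/eqP->; rewrite -scalar_mx_block.
  by apply: Or31.
by apply: Or32.
Qed.

(** * A common anticommuting vector and the grading it induces *)

Definition commutes_upto_sign n (X M : 'M[F]_n) :=
  exists e : bool, X *m M = (-1) ^+ e *: (M *m X).

Lemma commutes_upto_signM n (X M N : 'M[F]_n) :
  commutes_upto_sign X M -> commutes_upto_sign X N -> commutes_upto_sign X (M *m N).
Proof.
move=> [e eM] [f eN]; exists (e (+) f).
by rewrite mulmxA eM -scalemxAl -mulmxA eN -scalemxAr scalerA mulmxA signr_addb.
Qed.

Lemma common_anticommuting_vec5 (a : 'I_4 -> F) (B : 'I_4 -> 'M[F]_2) :
  exists b C, (b, C) != (0, 0) /\ forall k, b * a k *+ 2 + det2_polar C (B k) = 0.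
Proof.
(* Column k lists the coefficients of b, C 0 0, C 0 1, C 1 0, C 1 1 in the k-th equation; with five
   rows and four columns, [L] has a nonzero left kernel. *)
pose L : 'M[F]_(5, 4) := \matrix_(i, k)
  [:: a k *+ 2; B k 1 1; - B k 1 0; - B k 0 1; B k 0 0]`_i.
have: kermx L != 0.
  by rewrite -mxrank_eq0 mxrank_ker -lt0n subn_gt0 (leq_ltn_trans (rank_leq_col L)).
case/rowV0Pn => v /sub_kermxP vL0 v0.
have [b [C vE]] : exists b (C : 'M[F]_2),
    forall i, v 0 i = [:: b; C 0 0; C 0 1; C 1 0; C 1 1]`_i.
  (* Coordinate 0 is b; the entries of C follow in row-major order, whence the offset 1. *)
  exists (v 0 0), (\matrix_(i, j) v 0 (inord (1 + i * 2 + j))) => -[i hi].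
  rewrite !mxE; case: i hi => [|[|[|[|[|//]]]]] hi /=; congr (v 0 _);
  by apply/val_inj; rewrite /= ?inordK.
exists b, C; split.
  apply: contra v0 => /eqP[b0 C0]; apply/eqP/matrixP => i j.
  rewrite (ord1 i) vE b0 C0 !mxE.
  by case: j => -[|[|[|[|[|]]]]].
move=> k; have /matrixP/(_ 0 k) := vL0; rewrite mxE [RHS]mxE => <-.
rewrite !big_ord_recl big_ord0 !vE !mxE /= /det2_polar.
ring.
Qed.

Lemma involution_commutes_upto_sign M : M *m M = 1%:M ->
  M *m skew4 F = skew4 F *m M^T ->
  exists a B, forall b C, b * a *+ 2 + det2_polar C B = 0 ->
    commutes_upto_sign (vec5 b C) M.
Proof.
move=> MM /(involution_shape MM)[->|->|[a [B ->]]].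
(* A central involution commutes with everything, so the zero vector serves and its equation is
   vacuous. *)
- exists 0, 0 => b C _; exists false.
  by rewrite mulmx1 mul1mx scale1r.
- exists 0, 0 => b C _; exists false.
  by rewrite mul_scalar_mx mul_mx_scalar scale1r.
exists a, B => b C h; exists true; rewrite scaleN1r.
by apply/eqP; rewrite -addr_eq0 vec5_polar h raddf0.
Qed.

(** [M] is an isometry of [skew4] that preserves or exchanges U and W, and [t] is the value at [M]
    of the homomorphism to F_3. *)
Definition graded M t := exists P Q,
  [/\ det2 P = 1, det2 Q = 1, M = diag4 P Q \/ M = anti4 P Q & t = chi P + chi Q].

(** Exchanging the blocks only permutes the summands of a commutative sum, so [chiM] on each block
    suffices. *)
Lemma gradedM M N t r : graded M t -> graded N r -> graded (M *m N) (t + r).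
Proof.
move=> [P [Q [dP dQ eM ->]]] [P' [Q' [dP' dQ' eN ->]]].
case: eM eN => -> [] ->;
  rewrite /diag4 /anti4 mulmx_block !(mulmx0, mul0mx, addr0, add0r).
- exists (P *m P'), (Q *m Q'); rewrite !det2M dP dQ dP' dQ' mulr1 !(chiM) //.
  by split=> //; [left | ring].
- exists (P *m P'), (Q *m Q'); rewrite !det2M dP dQ dP' dQ' mulr1 !(chiM) //.
  by split=> //; [right | ring].
- exists (P *m Q'), (Q *m P'); rewrite !det2M dP dQ dP' dQ' mulr1 !(chiM) //.
  by split=> //; [right | ring].
- exists (P *m Q'), (Q *m P'); rewrite !det2M dP dQ dP' dQ' mulr1 !(chiM) //.
  by split=> //; [left | ring].
Qed.

Lemma graded_diag4 P Q t : det2 P = 1 -> graded (diag4 P Q) t -> t = chi P + chi Q.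
Proof.
move=> dP [P' [Q' [_ _ [] /eq_block_mx[eP _ _ eQ] ->]]]; first by rewrite eP eQ.
by move/eqP: dP; rewrite eP det20 eq_sym oner_eq0.
Qed.

Lemma chi_scalar (a : F) : chi (a%:M : 'M_2) = 0.
Proof. by rewrite /chi !mxE /=; ring. Qed.

Lemma det2_scalar (a : F) : det2 (a%:M : 'M_2) = a ^+ 2.
Proof. by rewrite /det2 !mxE /=; ring. Qed.

Lemma graded_scalar (a b : F) : a ^+ 2 = 1 -> b ^+ 2 = 1 -> graded (diag4 a%:M b%:M) 0.
Proof.
move=> a1 b1; exists a%:M, b%:M; rewrite !det2_scalar !chi_scalar addr0.
by split=> //; left.
Qed.

Lemma graded_involution M b : b != 0 -> M *m M = 1%:M ->
  M *m skew4 F = skew4 F *m M^T ->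
  commutes_upto_sign (vec5 b 0) M -> graded M 0.
Proof.
move=> b0 MM MJ; have [->|->|[a [B eM]]] := involution_shape MM MJ.
- by move=> _; rewrite scalar_mx_block; apply: graded_scalar; rewrite expr1n.
- by move=> _; rewrite scalar_mx_block; apply: graded_scalar; rewrite sqrrN expr1n.
have d1 : a ^+ 2 + det2 B = 1.
  by apply: (@eq_scalar_mx 3); rewrite -vec5_sqr -eM MM.
rewrite eM /vec5 => -[e].
rewrite adj20 !mulmx_block !(mulmx0, mul0mx, addr0, add0r) scale_block_mx.
rewrite -!scalar_mxM !mul_scalar_mx !mul_mx_scalar => /eq_block_mx[e1 e2 _ _].
case: e e1 e2 => /=; rewrite ?expr1 ?expr0 ?scaleN1r ?scale1r => e1 e2.
  (* Anticommuting case: M exchanges the planes through B and [adj2 B], which is the inverse of B,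
     so the two values of [chi] cancel. *)
  have a0 : a = 0.
    move: e1; rewrite -raddfN => /eq_scalar_mx/eqP; rewrite -addr_eq0 mulrC -mulr2n.
    by rewrite -mulr_natl !mulf_eq0 (negPf two_neq0) (negPf b0) orbF => /eqP.
  move: d1; rewrite a0 expr0n add0r => d1.
  have d1' : det2 (adj2 B) = 1.
    have := det2M B (adj2 B); rewrite mulmx_adj2 d1 det2_scalar expr1n mul1r.
    by move=> <-.
  exists B, (adj2 B); split=> //.
    by right; rewrite /vec5 /anti4 oppr0 raddf0.
  by rewrite -(chiM) // mulmx_adj2 d1 chi_scalar.
(* Commuting case: M acts by a sign on each plane. *)
have B0 : B = 0.
  apply/eqP; move/eqP: e2; rewrite scaleNr -addr_eq0 -mulr2n -scaler_nat !scaler_eq0.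
  by rewrite (negPf two_neq0) (negPf b0).
move: d1; rewrite B0 adj20 det20 addr0 => d1.
by apply: graded_scalar; rewrite ?sqrrN.
Qed.

(** Matrix of u on W, in the row convention: the first basis vector goes to eta times itself plus
    the second, an eigenvector. *)
Definition shear (eta : F) : 'M[F]_2 :=
  \matrix_(i, j) (if i == j then eta else (j == 1)%:R).

(** The upper right block gives C shear = ± skew2 C. Applied twice, this yields C shear^2 = -C; but
    shear^2 is unipotent, hence without eigenvalue -1. *)
Lemma diag4_commutes_vec5 eta b C : eta ^+ 2 = 1 ->
  commutes_upto_sign (vec5 b C) (diag4 (skew2 F) (shear eta)) -> C = 0.
Proof.
move=> eta1 [e]; rewrite /vec5 /diag4 !mulmx_block !(mulmx0, mul0mx, addr0, add0r).
rewrite scale_block_mx => /eq_block_mx[_ h _ _].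
have CB : C *m (shear eta *m shear eta) = - C.
  rewrite mulmxA h -scalemxAl -mulmxA h -scalemxAr scalerA -signr_addb addbb scale1r.
  by apply/mx2P; rewrite ?(mul2E, mxE) /=; ring.
have s2 : shear eta *m shear eta =
  \matrix_(i, j) (if i == j then 1 else (j == 1)%:R * - eta).
  apply/mx2P; rewrite mul2E !mxE /=; try ring: eta1.
  by transitivity (2%:R * eta); [ring | rewrite two_neg1 //; ring].
have C0 i : C i 0 = 0.
  by apply: eq_opp0; move/matrixP/(_ i 0): CB; rewrite s2 mul2E !mxE /= => <-; ring.
have C1 i : C i 1 = 0.
  apply: eq_opp0; move/matrixP/(_ i 1): CB.
  by rewrite s2 mul2E !mxE /= => <-; rewrite C0; ring.
by apply/mx2P; rewrite mxE.
Qed.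

Lemma four_involutions_neq eta (M : 'I_4 -> 'M[F]_(2 + 2)) : eta ^+ 2 = 1 ->
  (forall k, M k *m M k = 1%:M) -> (forall k, M k *m skew4 F = skew4 F *m (M k)^T) ->
  M 0 *m M 1 *m M 2%:R *m M 3%:R <> diag4 (skew2 F) (shear eta).
Proof.
move=> eta1 MM MJ eu.
have /fin_all_exists[a /fin_all_exists[B aB]] k :=
  involution_commutes_upto_sign (MM k) (MJ k).
have [b [C [bC0 bC]]] := common_anticommuting_vec5 a B.
have cM k : commutes_upto_sign (vec5 b C) (M k) by apply: aB.
have C0 : C = 0.
  by apply: (diag4_commutes_vec5 (b := b) eta1); rewrite -eu;
    do !apply: commutes_upto_signM.
rewrite {}C0 in bC0 cM; have b0 : b != 0.
  by apply: contraNneq bC0 => ->.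
have grM k : graded (M k) 0 by apply: (graded_involution b0).
have := gradedM (gradedM (gradedM (grM 0) (grM 1)) (grM 2%:R)) (grM 3%:R).
rewrite eu !addr0 => /graded_diag4.
have -> : det2 (skew2 F) = 1 by rewrite /det2 !mxE /=; ring.
(* The first term is 0 and the second is eta. *)
have -> : chi (skew2 F) + chi (shear eta) = eta by rewrite /chi !mxE /=; ring.
by move=> /(_ erefl) eta0; move/eqP: eta1; rewrite -eta0 expr0n eq_sym oner_eq0.
Qed.

End CharThree.

(** * Polynomials in an endomorphism *)

Section HornerLfun.
Variables (F : fieldType) (V : vectType F) (u : 'End(V)).
Implicit Types (p q : {poly F}).

Lemma iter_comp_lfunE i x : iter i (comp_lfun u) \1%VF x = iter i u x.
Proof. by elim: i => [|i IH] /=; rewrite ?id_lfunE // comp_lfunE IH. Qed.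

(** A bound larger than the size lets several polynomials share one range of summation. *)
Lemma horner_lfun_wide n p x : (size p <= n)%N ->
  horner_lfun u p x = \sum_(i < n) p`_i *: iter i u x.
Proof.
move=> le_pn; rewrite /horner_lfun sum_lfunE.
under eq_bigr => i _ do rewrite scale_lfunE iter_comp_lfunE.
rewrite (big_ord_widen n (fun i => p`_i *: iter i u x)) // big_mkcond /=.
by apply: eq_bigr => i _; case: ltnP => // /leq_sizeP->; rewrite ?scale0r.
Qed.

Lemma horner_lfunD p q x : horner_lfun u (p + q) x =
  horner_lfun u p x + horner_lfun u q x.
Proof.
pose n := maxn (size p) (size q).
rewrite !(@horner_lfun_wide n) ?leq_maxl ?leq_maxr ?size_polyD // -big_split /=.
by apply: eq_bigr => i _; rewrite coefD scalerDl.
Qed.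

Lemma horner_lfunZ c p x : horner_lfun u (c *: p) x = c *: horner_lfun u p x.
Proof.
rewrite !(@horner_lfun_wide (size p)) ?size_scale_leq // scaler_sumr.
by apply: eq_bigr => i _; rewrite coefZ scalerA.
Qed.

Lemma horner_lfunC c x : horner_lfun u c%:P x = c *: x.
Proof. by rewrite (@horner_lfun_wide 1) ?size_polyC_leq1 // big_ord1 coefC. Qed.

Lemma horner_lfunMX p x : horner_lfun u (p * 'X) x = u (horner_lfun u p x).
Proof.
rewrite (@horner_lfun_wide (size p).+1) ?(leq_trans (size_polyMleq _ _))
  ?size_polyX ?addn2 //.
rewrite (@horner_lfun_wide (size p) p) // big_ord_recl coefMX scale0r add0r linear_sum.
by apply: eq_bigr => i _; rewrite coefMX linearZ.
Qed.

Lemma horner_lfunM p q x : horner_lfun u (p * q) x =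
  horner_lfun u p (horner_lfun u q x).
Proof.
elim/poly_ind: p => [|p c IH].
  by rewrite mul0r -[0 in LHS]/(0%:P) -[0 in RHS]/(0%:P) !horner_lfunC !scale0r.
rewrite mulrDl mulrAC mul_polyC !horner_lfunD !horner_lfunMX IH horner_lfunZ.
by rewrite horner_lfunC.
Qed.

Lemma horner_lfunX x : horner_lfun u 'X x = u x.
Proof. by rewrite -['X]mul1r horner_lfunMX horner_lfunC scale1r. Qed.

Lemma horner_lfun_XsubC c x : horner_lfun u ('X - c%:P) x = u x - c *: x.
Proof. by rewrite -polyCN horner_lfunD horner_lfunX horner_lfunC scaleNr. Qed.

Lemma horner_lfun_X2add1 x : horner_lfun u ('X^2 + 1) x = u (u x) + x.
Proof. by rewrite horner_lfunD horner_lfunM !horner_lfunX horner_lfunC scale1r. Qed.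

(** Polynomials in u commute with each other. *)
Lemma horner_lfun_cyclic_eq0 p x : (forall y, exists q, y = horner_lfun u q x) ->
  horner_lfun u p x = 0 -> horner_lfun u p = 0.
Proof.
move=> gen px0; apply/lfunP => y; have [q ->] := gen y.
by rewrite -horner_lfunM mulrC horner_lfunM px0 linear0 zero_lfunE.
Qed.

Lemma horner_lfun_memv (S : {vspace V}) p x : (u @: S <= S)%VS -> x \in S ->
  horner_lfun u p x \in S.
Proof.
move=> uS xS; rewrite (@horner_lfun_wide (size p)) //; apply: memv_suml => i _.
apply/memvZ; elim: (i : nat) => //= j IH; apply/(subvP uS)/memv_img/IH.
Qed.
End HornerLfun.

(** * Matrices of endomorphisms through an invertible Gram matrix *)

Section Coordinates.
Variables (F : fieldType) (V : vectType F) (s : {biscalar V}) (n : nat).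
Variables (G : 'M[F]_n) (e : 'I_n -> V).
Hypothesis nondeg : forall x, (forall j, s x (e j) = 0) -> x = 0.
Hypothesis gram : forall i j, s (e i) (e j) = G i j.
Hypothesis unitG : G \in unitmx.
Implicit Types f g : 'End(V).

(* Row convention: row i holds the coordinates of f (e i), so coord_mx is
   antimultiplicative. *)
Definition coord_mx (f : 'End(V)) : 'M[F]_n :=
  (\matrix_(i, j) s (f (e i)) (e j)) *m invmx G.

Lemma coord_mxE f i : f (e i) = \sum_j coord_mx f i j *: e j.
Proof.
apply/eqP; rewrite -subr_eq0; apply/eqP/nondeg => k.
rewrite linearBl linear_sumlz /=; apply/eqP; rewrite subr_eq0; apply/eqP.
have /matrixP/(_ i k) : coord_mx f *m G = \matrix_(i, j) s (f (e i)) (e j).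
  by rewrite mulmxKV.
rewrite !mxE => <-; apply: eq_bigr => j _; by rewrite linearZl_LR gram.
Qed.

Lemma coord_mx_uniq f (A : 'M[F]_n) :
  (forall i, f (e i) = \sum_j A i j *: e j) -> coord_mx f = A.
Proof.
move=> h; apply/(canLR (mulmxK unitG))/matrixP => i k; rewrite !mxE h linear_sumlz.
by apply: eq_bigr => j _; rewrite linearZl_LR gram.
Qed.

Lemma coord_mx1 : coord_mx \1%VF = 1%:M.
Proof.
apply: coord_mx_uniq => i; rewrite id_lfunE (bigD1 i) //= big1 => [|j ji].
  by rewrite mxE eqxx scale1r addr0.
by rewrite mxE eq_sym (negPf ji) scale0r.
Qed.

Lemma coord_mxM f g : coord_mx (f \o g)%VF = coord_mx g *m coord_mx f.
Proof.
apply: coord_mx_uniq => i; rewrite comp_lfunE coord_mxE linear_sum.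
transitivity (\sum_j \sum_k (coord_mx g i j * coord_mx f j k) *: e k).
  apply: eq_bigr => j _; rewrite linearZ /= coord_mxE scaler_sumr.
  by apply: eq_bigr => k _; rewrite scalerA.
by rewrite exchange_big; apply: eq_bigr => k _; rewrite mxE scaler_suml.
Qed.

Lemma coord_mx_isometry f : (forall x y, s (f x) (f y) = s x y) ->
  coord_mx f *m G *m (coord_mx f)^T = G.
Proof.
move=> isof; apply/matrixP => i j; rewrite -[RHS]gram -isof (coord_mxE f j) linear_sumr.
rewrite mxE; apply: eq_bigr => k _; rewrite linearZr_LR /= [X in _ * s X _]coord_mxE.
rewrite linear_sumlz !mxE mulrC; congr (_ * _).
by apply: eq_bigr => l _; rewrite linearZl_LR gram.
Qed.
End Coordinates.

(** * A basis adapted to the decomposition into U and W *)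

Section AdaptedBasis.
Variables (F : fieldType) (V : vectType F) (s : {biscalar V}) (u : 'End(V)).
Variable eta : F.
Hypothesis F3 : forall x : F, exists2 n, (n < 3)%N & x = n%:R.
Hypothesis char3 : 3%:R = 0 :> F.
Hypothesis eta1 : eta ^+ 2 = 1.
Hypothesis alt : alternating s.
Hypothesis isou : forall x y, s (u x) (u y) = s x y.

Lemma alternating_antisym x y : s y x = - s x y.
Proof.
apply/eqP; rewrite -addr_eq0 addrC; apply/eqP.
by have := alt (x + y); rewrite linearDl !linearDr /= !alt add0r addr0.
Qed.

Lemma F3_sqr1 (x : F) : x != 0 -> x = 1 \/ x = -1.
Proof.
have [[|[|[|//]]] _ ->] := F3 x; first by rewrite eqxx.
  by left.
by right; rewrite two_neg1.
Qed.

(** Compare [s p q] with its image under u^2, which is -1 on p, 1 on n = u q - eta q, and sends q to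
    q + 2 eta n: first s p n, then s p q, equals its own opposite. *)
Lemma isotypic_orthogonal p q : u (u p) = - p ->
  u (u q - eta *: q) = eta *: (u q - eta *: q) -> s p q = 0.
Proof.
move=> up; set n := u q - eta *: q => un.
have {n un} [n [uq un]] : exists n, u q = n + eta *: q /\ u n = eta *: n.
  by exists n; rewrite subrK.
have scale_eta2 (z : V) : eta *: (eta *: z) = z by rewrite scalerA -expr2 eta1 scale1r.
have pn : s p n = 0.
  apply: (eq_opp0 char3); rewrite -{1}isou -{1}isou up !un linearZ /= un scale_eta2.
  by rewrite linearNl.
apply: (eq_opp0 char3); rewrite -{1}isou -{1}isou up uq linearD linearZ /= un uq.
rewrite scalerDr scale_eta2 linearNl !linearDr /= linearZr_LR /= pn.
by rewrite mulr0 !add0r.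
Qed.

(** Gives both planes the same Gram factor c. Replacing v by v + u v multiplies s v (u v) by 2 = -1,
    so both nonzero values occur. *)
Lemma rescaled_generator v c : c != 0 -> s v (u v) != 0 -> u (u v) = - v ->
  exists v', [/\ u (u v') = - v', s v' (u v') = c & forall y,
    s y v' = 0 -> s y (u v') = 0 -> s y v = 0 /\ s y (u v) = 0].
Proof.
move=> c0 d0 uv; have [dc|dc] := eqVneq (s v (u v)) c; first by exists v.
exists (v + u v); have -> : u (v + u v) = u v - v by rewrite linearD /= uv.
split=> [||y].
- by rewrite linearB /= uv -opprD addrC.
- have -> : c = - s v (u v).
    move: dc; have [->|->] := F3_sqr1 c0; have [->|->] := F3_sqr1 d0;
    by rewrite ?eqxx ?opprK.
  rewrite linearDl !linearBr /= !alt (alternating_antisym v (u v)) subr0 sub0r opprK.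
  by rewrite -mulr2n -mulr_natl two_neg1 // mulN1r.
rewrite linearDr linearBr /= => /eqP; rewrite addr_eq0 => /eqP e1 /eqP.
rewrite subr_eq0 => /eqP e2; have yv : s y v = 0.
  by apply: (eq_opp0 char3); rewrite {1}e1 e2.
by rewrite e2.
Qed.

Hypothesis nondeg : nondegenerate_form s.
Hypothesis minu : is_minpoly u (('X^2 + 1) * ('X - eta%:P) ^+ 2).
Variable x0 : V.
Hypothesis gen : forall y, exists p, y = horner_lfun u p x0.

(** A polynomial killing the cyclic vector is a multiple of the minimal polynomial, and the degree
    of q is too small. *)
Lemma proper_divisor_minpoly_neq0 p q : p * q = ('X^2 + 1) * ('X - eta%:P) ^+ 2 ->
  (1 < size p)%N -> q != 0 -> horner_lfun u q x0 != 0.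
Proof.
move=> epq p1 q0; apply/eqP => /(horner_lfun_cyclic_eq0 gen).
have [_ _ mindvd] := minu; move=> /mindvd /(dvdp_leq q0).
rewrite -epq size_mul //; last by rewrite -size_poly_gt0 ltnW.
by rewrite leqNgt -subn1 ltn_subRL ltn_add2r p1.
Qed.

Lemma size_X2add1 : size ('X^2 + 1 : {poly F}) = 3.
Proof. by rewrite size_polyDl size_polyXn // size_poly1. Qed.

Lemma adapted_basis : exists c (e : 'I_(2 + 2) -> V),
  [/\ c != 0, forall x, (forall j, s x (e j) = 0) -> x = 0,
      forall i j, s (e i) (e j) = (c *: skew4 F) i j &
      forall i, u (e i) = \sum_j diag4 (skew2 F) (shear eta) i j *: e j].
Proof.
pose v := horner_lfun u (('X - eta%:P) ^+ 2) x0.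
pose w := horner_lfun u ('X^2 + 1) x0.
pose n := u w - eta *: w.
have min0 : horner_lfun u (('X^2 + 1) * ('X - eta%:P) ^+ 2) x0 = 0.
  by have [_ -> _] := minu; rewrite zero_lfunE.
have uv : u (u v) = - v.
  by apply/eqP; rewrite -addr_eq0 -horner_lfun_X2add1 -horner_lfunM min0.
have nE : n = horner_lfun u ('X - eta%:P) (horner_lfun u ('X^2 + 1) x0).
  by rewrite horner_lfun_XsubC.
have un : u n = eta *: n.
  apply/eqP; rewrite -subr_eq0 -(horner_lfun_XsubC u eta n) nE -!horner_lfunM.
  by rewrite -expr2 mulrC min0.
have uw : u w = n + eta *: w by rewrite subrK.
have v0 : v != 0.
  apply: (proper_divisor_minpoly_neq0 (p := 'X^2 + 1)); rewrite ?size_X2add1 //.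
  by rewrite expf_eq0 polyXsubC_eq0.
have n0 : n != 0.
  rewrite nE -horner_lfunM.
  apply: (proper_divisor_minpoly_neq0 (p := 'X - eta%:P)); rewrite ?size_XsubC //.
    by rewrite mulrA -expr2 mulrC.
  by rewrite mulf_neq0 ?polyXsubC_eq0 // -size_poly_gt0 size_X2add1.
have orthUW p : u (u p) = - p -> s p w = 0 /\ s p n = 0.
  move=> up; split; apply: isotypic_orthogonal => //.
  by rewrite un subrr linear0 scaler0.
have uuv : u (u (u v)) = - u v by rewrite uv linearN.
have [vw vn] := orthUW _ uv; have [uvw uvn] := orthUW _ uuv.
pose X := [tuple v; u v; w; n].
have XS i : (i < 4)%N -> X`_i \in <<X>>%VS by move=> hi; rewrite memv_span ?mem_nth.
have [Xv Xuv Xw Xn] := And4 (XS 0%N isT) (XS 1%N isT) (XS 2%N isT) (XS 3%N isT).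
have uX : (u @: <<X>> <= <<X>>)%VS.
  rewrite limg_span; apply/span_subvP => z.
  rewrite !inE => /or4P[] /eqP->; rewrite ?uv ?uw ?un ?rpredN //.
    by rewrite rpredD // rpredZ.
  by rewrite rpredZ.
have x0X : x0 \in <<X>>%VS.
  (* The two factors of the minimal polynomial differ by -2 eta X, so they are coprime, and x0 is
     recovered from v and w. *)
  have bezout : 1 = ('X^2 + 1) +
      (- eta%:P * 'X) * (('X - eta%:P) ^+ 2 - ('X^2 + 1)) :> {poly F}.
    have e2 : eta%:P ^+ 2 = 1 :> {poly F} by rewrite -rmorphXn /= eta1.
    have t0 : 3%:R = 0 :> {poly F} by rewrite -[3%:R]polyC_natr char3.
    transitivity (1 + 3%:R * 'X^2 : {poly F}); first by rewrite t0 mul0r addr0.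
    by ring: e2.
  rewrite -[x0](scale1r x0) -(horner_lfunC u) [1%:P]bezout horner_lfunD rpredD //.
  rewrite horner_lfunM horner_lfun_memv // horner_lfunD rpredD //.
  by rewrite -scaleN1r horner_lfunZ rpredZ.
have nd y : s y v = 0 -> s y (u v) = 0 -> s y w = 0 -> s y n = 0 -> y = 0.
  move=> yv yuv yw yn; apply: nondeg => z.
  have : z \in <<X>>%VS by have [p ->] := gen z; rewrite horner_lfun_memv.
  move=> /coord_span->; rewrite linear_sumr !big_ord_recl big_ord0 /=.
  by rewrite !linearZr_LR /= yv yuv yw yn !mulr0 !addr0.
(* Otherwise v would be orthogonal to all four spanning vectors; likewise for n below. *)
have d0 : s v (u v) != 0.
  by apply: contra v0 => /eqP d0; apply/eqP/nd; rewrite ?alt.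
have c0 : s w n != 0.
  apply: contra n0 => /eqP c0; apply/eqP/nd; rewrite ?alt // alternating_antisym.
  - by rewrite vn oppr0.
  - by rewrite uvn oppr0.
  - by rewrite c0 oppr0.
have [v' [uv' dv' v'P]] := rescaled_generator c0 d0 uv.
have uuv' : u (u (u v')) = - u v' by rewrite uv' linearN.
have [v'w v'n] := orthUW _ uv'; have [uv'w uv'n] := orthUW _ uuv'.
have sym0 x y : s x y = 0 -> s y x = 0.
  by rewrite (alternating_antisym x y) => ->; rewrite oppr0.
pose eU (i : 'I_2) := if i == 0 then v' else u v'.
pose eW (i : 'I_2) := if i == 0 then w else n.
pose e (i : 'I_(2 + 2)) := match split i with inl k => eU k | inr k => eW k end.
have el k : e (lshift 2 k) = eU k.
  by rewrite /e; case: split_ordP => j /eqP; rewrite ?eq_shift // => /eqP->.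
have er k : e (rshift 2 k) = eW k.
  by rewrite /e; case: split_ordP => j /eqP; rewrite ?eq_shift // => /eqP->.
exists (s w n), e; split=> //.
- move=> y ye; have yU k : s y (eU k) = 0 by rewrite -el.
  have yW k : s y (eW k) = 0 by rewrite -er.
  have [yv yuv] := v'P y (yU 0) (yU 1).
  by apply: nd => //; [apply: (yW 0) | apply: (yW 1)].
- move=> i j; rewrite mxE /skew4.
  case: (split_ordP i) => k ->; case: (split_ordP j) => l ->;
    rewrite ?el ?er ?block_mxEul ?block_mxEur ?block_mxEdl ?block_mxEdr !mxE /eU /eW;
    have [->|->] := ord2P k; have [->|->] := ord2P l;
    rewrite /= ?alt ?subrr ?mulr0 ?sub0r ?subr0 ?mulr1 ?mulrN1 //; try exact: sym0.
  + by rewrite alternating_antisym dv'.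
  + by rewrite alternating_antisym.
move=> i; rewrite big_split_ord /diag4 /=.
under eq_bigr => j _ do rewrite el.
under [X in _ + X]eq_bigr => j _ do rewrite er.
case: (split_ordP i) => k ->; rewrite ?el ?er.
  under eq_bigr => j _ do rewrite block_mxEul.
  under [X in _ + X]eq_bigr => j _ do rewrite block_mxEur mxE scale0r.
  rewrite big1_eq addr0 !big_ord_recl big_ord0 addr0 /eU !mxE /=.
  have [->|->] := ord2P k; rewrite /= ?subrr ?subr0 ?sub0r ?scale0r ?scale1r ?add0r //.
  by rewrite scaleN1r addr0.
under eq_bigr => j _ do rewrite block_mxEdl mxE scale0r.
under [X in _ + X]eq_bigr => j _ do rewrite block_mxEdr.
rewrite big1_eq add0r !big_ord_recl big_ord0 addr0 /eW !mxE /=.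
have [->|->] := ord2P k; rewrite /= ?scale0r ?scale1r ?add0r //.
by rewrite addrC.
Qed.
End AdaptedBasis.

(** * Transfer to matrices and conclusion *)

Lemma skew4_unit (F : fieldType) (c : F) : c != 0 -> c *: skew4 F \in unitmx.
Proof.
move=> c0; have skew4K : skew4 F *m skew4 F = - 1%:M.
  have := skew2K (1%:M : 'M[F]_2); rewrite mul1mx /skew4 mulmx_block => ->.
  rewrite !(mulmx0, mul0mx, addr0, add0r) [in RHS]scalar_mx_block opp_block_mx.
  by rewrite !oppr0.
have [] // := @mulmx1_unit F (2 + 2) (c *: skew4 F) (- c^-1 *: skew4 F).
by rewrite -scalemxAl -scalemxAr scalerA mulrN mulfV // skew4K scaleN1r opprK.
Qed.

Theorem proposition7p6 (F : finFieldType) (hF : #|F| = 3%N) (V : vectType F)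
    (s : {biscalar V}) (hs : symplectic_form s)
    (u : 'End(V)) (hu : Sp s u) (hcyc : cyclic_endo u)
    (eta : F) (heta : eta = 1 \/ eta = -1)
    (hmin : is_minpoly u (('X^2 + 1) * ('X - eta%:P) ^+ 2)) :
  ~ reflectional (Sp s) 4 u.
Proof.
have F3 := card3_natP hF.
have char3 := card3_char hF.
have eta1 : eta ^+ 2 = 1 by case: heta => ->; rewrite ?sqrrN expr1n.
have [[alt nondeg] [_ isou] [x0 gen]] := And3 hs hu hcyc.
have [c [e [c0 nde gram ue]]] := adapted_basis F3 char3 eta1 alt isou nondeg hmin gen.
have unitG := skew4_unit c0.
(* The order is reversed because [coord_mx] is antimultiplicative. *)
move=> [r invr eu]; pose M k := coord_mx s (c *: skew4 F) e (tnth r (rev_ord k)).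
have MM k : M k *m M k = 1%:M.
  have [_ rr] := invr (rev_ord k).
  by rewrite -(coord_mxM nde gram unitG) rr (coord_mx1 gram unitG).
(* An isometry that is its own inverse is self-adjoint. *)
have MJ k : M k *m skew4 F = skew4 F *m (M k)^T.
  have [[_ isor] _] := invr (rev_ord k).
  have := coord_mx_isometry nde gram unitG isor; rewrite -/(M k) => MGM.
  apply: (scalerI c0); rewrite scalemxAr scalemxAl -{2}MGM -mulmxA -trmx_mul MM.
  by rewrite trmx1 mulmx1.
apply: (four_involutions_neq F3 char3 eta1 MM MJ).
rewrite -(coord_mx_uniq gram unitG ue) eu !big_ord_recl big_ord0.
rewrite !(coord_mxM nde gram unitG) (coord_mx1 gram unitG) mul1mx.
by congr (_ *m _ *m _ *m _); congr (coord_mx _ _ _ (tnth r _)); apply/val_inj.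
Qed.
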